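(* Let $p$ be a prime and $d$ an integer greater than $2$. Then $h(M(p^d))=p^{\,p^{d-2}(p-1)}$.
   Context: For a finite group $G$ with conjugacy classes $K_1,\dots,K_s$ and irreducible complex characters $\chi_1,\dots,\chi_s$, Harada's number is $h(G)=\frac{|K_1|\cdots|K_s|}{\chi_1(1)\cdots\chi_s(1)}$. For a prime $p$ and an integer $d>2$, $M(p^d)=\langle x,y\mid x^{p^{d-1}}=y^p=1,\ x^y=x^{1+p^{d-2}}\rangle$, where $x^y=y^{-1}xy$. *)

(* Defs.v *)
From mathcomp Require Import all_boot all_order all_algebra all_fingroup.
From mathcomp Require Import all_solvable all_field all_character.

Set Implicit Arguments.
Unset Strict Implicit.
Unset Printing Implicit Defensive.

Import GRing.Theory.
Local Open Scope ring_scope.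

(* [harada G] is only known a priori to be a nonnegative rational number, so
   the quotient is taken in the field algC where characters take their values. *)
Definition harada (gT : finGroupType) (G : {group gT}) : algC :=
  (\prod_(K in classes G) #|K|%:R) / (\prod_(i : Iirr G) 'chi[G]_i 1%g).

(* Main.v *)
Require Import Defs.
From mathcomp Require Import all_boot all_order all_algebra all_fingroup.
From mathcomp Require Import all_solvable all_field all_character.

(** Why Harada's number of the modular group of order p ^ d is a power of p.

    The derived subgroup has order p and the center has index p ^ 2.  The first
    fact bounds a conjugacy class by p, since a class lies in one coset of the
    derived subgroup.  The second one bounds an irreducible degree by p, since
    the square of a degree is at most the index of the center.  Class sizes and
    degrees also divide p ^ 2, so all of them are equal to 1 or p
    ([class_card_1p], [irr1_1p]).

    When only the two values 1 and n occur, no class of size n has to be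
    counted.  There are as many classes as irreducible characters, say k; the
    classes of size 1 are the central elements, and the characters of degree 1
    are as many as the index of the derived subgroup.  Hence the numerator of
    Harada's number is n ^ (k - |Z(G)|), the denominator is n ^ (k - |G : G'|),
    and k cancels: the quotient is n ^ (|G : G'| - |Z(G)|)
    ([harada_two_values]).  For the modular group the exponent is
    p ^ (d - 1) - p ^ (d - 2) = p ^ (d - 2) * (p - 1). *)

Set Implicit Arguments.
Unset Strict Implicit.
Unset Printing Implicit Defensive.

Import GroupScope Order.TTheory GRing.Theory Num.Theory.

Section TwoValues.

Variables (gT : finGroupType) (G : {group gT}).

Lemma card_central_classes : #|[set K in classes G | #|K| == 1%N]| = #|'Z(G)|.
Proof.
rewrite -(card_imset _ (@set1_inj gT)).
apply: eq_card => K; rewrite inE; apply/andP/imsetP.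
  case=> /imsetP[x Gx ->] /cards1P[y def_y].
  have def_x: x ^: G = [set x].
    by rewrite def_y; congr [set _]; apply/esym/set1P; rewrite -def_y class_refl.
  exists x; last by [].
  rewrite inE Gx; apply/centP=> z Gz; apply/commgP/conjg_fixP/set1P.
  by rewrite -def_x memJ_class.
case=> x Zx ->; have [Gx /centP cGx] := setIP Zx; rewrite cards1; split=> //.
apply/imsetP; exists x => //; apply/esym/eqP.
rewrite eqEsubset sub1set class_refl andbT; apply/subsetP=> _ /imsetP[z Gz ->].
by rewrite inE; apply/eqP/conjg_fixP/commgP/cGx.
Qed.

(** The exponents are kept on both sides of a product, which avoids the
    difference |G : G'| - |Z(G)| and the need to know its sign. *)
Lemma harada_two_values (n : nat) : (0 < n)%N ->
    (forall K, K \in classes G -> #|K| = 1%N \/ #|K| = n) ->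
    (forall i, 'chi[G]_i 1%g = 1 \/ 'chi[G]_i 1%g = n%:R)%R ->
  (harada G * (n ^ #|'Z(G)|)%:R = (n ^ #|G : G^`(1)|)%:R)%R.
Proof.
move=> n_gt0 class_n chi_n.
(* Completing each class size to n: a class of size 1 receives one more factor
   n, and there are |Z(G)| of these. *)
have clE : (\prod_(K in classes G) #|K| * n ^ #|'Z(G)| = n ^ #|classes G|)%N.
  rewrite -card_central_classes -!prod_nat_const.
  under [X in (_ * X)%N]eq_bigl => K do rewrite inE.
  rewrite [X in (_ * X)%N]big_mkcondr /= -big_split.
  apply: eq_bigr => K /class_n.
  by case: eqP => [-> _ | nK1 [/nK1 //|->]]; rewrite /= ?mul1n ?muln1.
(* The same completion for the degrees, with the linear characters. *)
have chiE : (\prod_(i : Iirr G) 'chi_i 1%g * (n ^ #|G : G^`(1)|)%:R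
              = (n ^ #|classes G|)%:R :> algC)%R.
  have -> : #|classes G| = #|Iirr G| by rewrite card_ord NirrE.
  rewrite -card_lin_irr -!prod_nat_const.
  rewrite !natr_prod [X in (_ * X)%R]big_mkcond /= -big_split; apply: eq_bigr => i _.
  rewrite inE qualifE /= irr_char /=.
  case: eqP => [-> | nchi1]; first by rewrite /= mul1r.
  by case: (chi_n i) => [/nchi1 //| ->]; rewrite /= mulr1.
have nz_chi : (\prod_(i : Iirr G) 'chi_i 1%g != 0 :> algC)%R.
  by apply/prodf_neq0 => i _; apply: irr1_neq0.
apply: (mulfI nz_chi); rewrite chiE -clE natrM natr_prod /harada.
by rewrite mulrA mulrCA divff // mulr1.
Qed.

End TwoValues.

Section CentralIndexSquare.

Variables (gT : finGroupType) (G : {group gT}) (p : nat).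
Hypotheses (p_pr : prime p) (iZ : #|G : 'Z(G)| = (p ^ 2)%N).

(** The class of x lies in the coset of x modulo G', because conjugates of x
    are the products x * [x, z]; and its size is the index of a centralizer,
    which contains the center. *)
Lemma class_card_1p K :
    #|G^`(1)| = p -> K \in classes G ->
  #|K| = 1%N \/ #|K| = p.
Proof.
move=> oG' /imsetP[x Gx ->].
have leKp : #|x ^: G| <= p.
  rewrite -oG' -(card_lcoset G^`(1) x); apply/subset_leq_card/subsetP=> u.
  case/imsetP=> z Gz ->{u}; apply/lcosetP; exists [~ x, z].
    by rewrite mem_commg.
  by rewrite conjg_mulR.
have dvK : #|x ^: G| %| p ^ 2.
  rewrite -index_cent1 -iZ indexgS // setIS //.
  by rewrite /= -cent_set1 centS ?sub1set.
case/(dvdn_pfactor _ _ p_pr): dvK leKp => -[|[|[|m]]] // _ ->.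
- by left.
- by right.
by rewrite leqNgt (ltn_exp2l 1 2 (prime_gt1 p_pr)).
Qed.

(** Both bounds come from the center of the character, which contains the
    center of G: a degree divides its index (so it is 1, p or p ^ 2), and the
    square of the degree does not exceed it. *)
Lemma irr1_1p i : ('chi[G]_i 1%g = 1 \/ 'chi[G]_i 1%g = p%:R)%R.
Proof.
have sZZ : 'Z(G) \subset 'Z(('chi_i)%R)%CF.
  by rewrite -cap_cfcenter_irr; apply: bigcap_inf.
have iZchi : #|G : 'Z(('chi_i)%R)%CF| %| p ^ 2 by rewrite -iZ indexgS.
have /natrP[n chi1] := Cnat_irr1 i; rewrite chi1.
have dvn : n %| p ^ 2.
  apply: dvdn_trans iZchi.
  by have := dvd_irr1_index_center i; rewrite chi1 dvdC_nat.
have len : n ^ 2 <= p ^ 2.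
  apply: leq_trans (dvdn_leq _ iZchi); rewrite ?expn_gt0 ?prime_gt0 //.
  by have [+ _] := irr1_bound i; rewrite chi1 -natrX ler_nat.
case/(dvdn_pfactor _ _ p_pr): dvn len => -[|[|[|m]]] // _ ->.
- by left.
- by right.
by rewrite leq_exp2r // leqNgt (ltn_exp2l 1 2 (prime_gt1 p_pr)).
Qed.

End CentralIndexSquare.

(** Two groups with the same presentation map onto each other, so they are
    isomorphic; the structure theory of the modular group thus applies to any
    group with this presentation. *)
Lemma isog_Mod p d (gT : finGroupType) (G : {group gT}) : prime p -> d > 2 ->
    G \isog Grp (x : y : x ^+ (p ^ (d - 1))%N, y ^+ p,
                         x ^ y = x ^+ (1 + p ^ (d - 2))%N) ->
  G \isog 'Mod_(p ^ d).
Proof.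
move=> p_pr d_gt2 defG; have defM := Grp_modular_group p_pr d_gt2.
rewrite -subn2 -subn1 -add1n in defM.
by rewrite isogEhom defM (isoGrp_hom defG) defG (isoGrp_hom defM).
Qed.

Theorem proposition4p8 (p d : nat) (p_prime : prime p) (d_gt2 : (2 < d)%N)
    (gT : finGroupType) (G : {group gT})
    (defG : (G \isog Grp (x : y : x ^+ (p ^ (d - 1))%N, y ^+ p,
                                  x ^ y = x ^+ (1 + p ^ (d - 2))%N))%g) :
  harada G = ((p ^ (p ^ (d - 2) * (p - 1)))%:R)%R.
Proof.
have isoM := isog_Mod p_prime d_gt2 defG; have p_gt0 := prime_gt0 p_prime.
have [[x y] genG modG] := generators_modular_group p_prime d_gt2 isoM.
have [oG _ _ _] := genG.
have [_ [_ _ oZ] [_ oG' _] _ _] :=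
  modular_group_structure p_prime d_gt2 genG isoM modG.
rewrite -subn2 in oZ.
have iZ : #|G : 'Z(G)| = (p ^ 2)%N.
  by rewrite -divgS ?center_sub // oG oZ -expnB ?subKn ?leq_subr // ltnW.
have iG' : #|G : G^`(1)| = (p ^ (d - 2) * p)%N.
  rewrite -divgS ?der_sub // oG oG' -expnSr -subSn 1?ltnW // subSS subn1.
  by rewrite -{1}(ltn_predK d_gt2) expnSr mulnK.
have hE := harada_two_values p_gt0
  (fun K => class_card_1p p_prime iZ oG') (irr1_1p p_prime iZ).
have nz : ((p ^ #|'Z(G)|)%:R != 0 :> algC)%R.
  by rewrite pnatr_eq0 expn_eq0 (gtn_eqF p_gt0).
apply: (mulIf nz); rewrite hE -natrM -expnD iG' oZ.
by rewrite mulnBr muln1 subnK // leq_pmulr.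
Qed.
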